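(* Let $\mathbf{R}=\mathbb{Z}_{n}$ be the ring of integers modulo $n$. If $n=2^{t}$ with $t$ a positive integer, then $|U(\mathcal{H}_{\mathbf{R}})|=\phi(|\mathcal{H}_{\mathbf{R}}|)$.
   Context: For a commutative unital ring $\mathbf{R}$, the ring of quaternions over $\mathbf{R}$ is $\mathcal{H}_{\mathbf{R}}=\{ w+xi+yj+zk \mid w,x,y,z\in \mathbf{R}\}$ (the free $\mathbf{R}$-module with basis $1,i,j,k$), with componentwise addition and $\mathbf{R}$-bilinear multiplication determined by the identity $1$ and the rules $i^{2}=j^{2}=k^{2}=-1$, $ij=k$, $jk=i$, $ki=j$, $ji=-k$, $kj=-i$, $ik=-j$. $U(\cdot)$ denotes the group of units, $|\cdot|$ denotes cardinality, and $\phi$ is Euler's totient function. *)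

(* Defs.v *)
From HB Require Import structures.
From mathcomp Require Import all_boot all_order all_algebra ring.

Set Implicit Arguments.
Unset Strict Implicit.
Unset Printing Implicit Defensive.

Import GRing.Theory.
Local Open Scope ring_scope.

(* Quat w x y z stands for w + x i + y j + z k. *)
Record quat (R : Type) := Quat { qw : R; qx : R; qy : R; qz : R }.

Section Encoding.
Variable R : Type.
Definition prod_of_quat (q : quat R) : R * R * R * R :=
  (qw q, qx q, qy q, qz q).
Definition quat_of_prod (p : R * R * R * R) : quat R :=
  let: (w, x, y, z) := p in Quat w x y z.
Lemma prod_of_quatK : cancel prod_of_quat quat_of_prod.
Proof. by case. Qed.
Lemma quat_of_prodK : cancel quat_of_prod prod_of_quat.
Proof. by case=> [[[]]]. Qed.
End Encoding.

HB.instance Definition _ (R : eqType) :=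
  Equality.copy (quat R) (can_type (@prod_of_quatK R)).
HB.instance Definition _ (R : choiceType) :=
  Choice.copy (quat R) (can_type (@prod_of_quatK R)).
HB.instance Definition _ (R : countType) :=
  Countable.copy (quat R) (can_type (@prod_of_quatK R)).
HB.instance Definition _ (R : finType) :=
  Finite.copy (quat R) (can_type (@prod_of_quatK R)).

Section Ring.
Variable R : comPzRingType.
Implicit Types p q r : quat R.

Definition quat_add p q :=
  Quat (qw p + qw q) (qx p + qx q) (qy p + qy q) (qz p + qz q).
Definition quat_opp q := Quat (- qw q) (- qx q) (- qy q) (- qz q).
Definition quat_zero : quat R := Quat 0 0 0 0.
Definition quat_one : quat R := Quat 1 0 0 0.
Definition quat_scale (a : R) q :=
  Quat (a * qw q) (a * qx q) (a * qy q) (a * qz q).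

(* The R-bilinear extension of the multiplication table of 1, i, j, k;
   see the lemmas qii, ..., qik below. *)
Definition quat_mul p q := Quat
  (qw p * qw q - qx p * qx q - qy p * qy q - qz p * qz q)
  (qw p * qx q + qx p * qw q + qy p * qz q - qz p * qy q)
  (qw p * qy q - qx p * qz q + qy p * qw q + qz p * qx q)
  (qw p * qz q + qx p * qy q - qy p * qx q + qz p * qw q).

Let quat_addA : associative quat_add.
Proof. by move=> p q r; rewrite /quat_add /= !addrA. Qed.
Let quat_addC : commutative quat_add.
Proof. by move=> p q; congr Quat; apply: addrC. Qed.
Let quat_add0l : left_id quat_zero quat_add.
Proof. by case=> *; rewrite /quat_add /= !add0r. Qed.
Let quat_addNl : left_inverse quat_zero quat_opp quat_add.
Proof. by case=> *; rewrite /quat_add /= !addNr. Qed.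
HB.instance Definition _ :=
  GRing.isZmodule.Build (quat R) quat_addA quat_addC quat_add0l quat_addNl.

Let quat_mulA : associative quat_mul.
Proof. by move=> p q r; rewrite /quat_mul /=; congr Quat; ring. Qed.
Let quat_mul1l : left_id quat_one quat_mul.
Proof. by case=> *; rewrite /quat_mul /=; congr Quat; ring. Qed.
Let quat_mulr1 : right_id quat_one quat_mul.
Proof. by case=> *; rewrite /quat_mul /=; congr Quat; ring. Qed.
Let quat_mulDl : left_distributive quat_mul quat_add.
Proof. by move=> p q r; rewrite /quat_mul /quat_add /=; congr Quat; ring. Qed.
Let quat_mulDr : right_distributive quat_mul quat_add.
Proof. by move=> p q r; rewrite /quat_mul /quat_add /=; congr Quat; ring. Qed.
HB.instance Definition _ :=
  GRing.Zmodule_isPzRing.Build (quat R)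
    quat_mulA quat_mul1l quat_mulr1 quat_mulDl quat_mulDr.

Let quat_scaleA a b q : quat_scale a (quat_scale b q) = quat_scale (a * b) q.
Proof. by rewrite /quat_scale /= !mulrA. Qed.
Let quat_scale1l : left_id 1 quat_scale.
Proof. by case=> *; rewrite /quat_scale /= !mul1r. Qed.
Let quat_scaleDr : right_distributive quat_scale +%R.
Proof. by move=> a p q; congr Quat; apply: mulrDr. Qed.
Let quat_scaleDl q : {morph quat_scale^~ q : a b / a + b}.
Proof. by move=> a b; congr Quat; apply: mulrDl. Qed.
HB.instance Definition _ :=
  GRing.Zmodule_isLmodule.Build R (quat R)
    quat_scaleA quat_scale1l quat_scaleDr quat_scaleDl.

Definition qi : quat R := Quat 0 1 0 0.
Definition qj : quat R := Quat 0 0 1 0.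
Definition qk : quat R := Quat 0 0 0 1.

Lemma quatE (w x y z : R) :
  Quat w x y z = w *: (1 : quat R) + x *: qi + y *: qj + z *: qk.
Proof. by congr Quat => /=; ring. Qed.

Lemma quat_scaleAl (a : R) p q : a *: (p * q) = (a *: p) * q.
Proof. by congr Quat => /=; ring. Qed.
Lemma quat_scaleAr (a : R) p q : a *: (p * q) = p * (a *: q).
Proof. by congr Quat => /=; ring. Qed.

Lemma qii : qi * qi = -1. Proof. by congr Quat => /=; ring. Qed.
Lemma qjj : qj * qj = -1. Proof. by congr Quat => /=; ring. Qed.
Lemma qkk : qk * qk = -1. Proof. by congr Quat => /=; ring. Qed.
Lemma qij : qi * qj = qk. Proof. by congr Quat => /=; ring. Qed.
Lemma qjk : qj * qk = qi. Proof. by congr Quat => /=; ring. Qed.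
Lemma qki : qk * qi = qj. Proof. by congr Quat => /=; ring. Qed.
Lemma qji : qj * qi = - qk. Proof. by congr Quat => /=; ring. Qed.
Lemma qkj : qk * qj = - qi. Proof. by congr Quat => /=; ring. Qed.
Lemma qik : qi * qk = - qj. Proof. by congr Quat => /=; ring. Qed.
End Ring.

Lemma quat_one_neq0 (R : comNzRingType) : (1 : quat R) != 0.
Proof. by apply/eqP=> -[] /eqP; rewrite oner_eq0. Qed.
HB.instance Definition _ (R : comNzRingType) :=
  GRing.PzSemiRing_isNonZero.Build (quat R) (@quat_one_neq0 R).

HB.instance Definition _ (R : comNzRingType) :=
  GRing.Lmodule_isLalgebra.Build R (quat R) (@quat_scaleAl R).
HB.instance Definition _ (R : comNzRingType) :=
  GRing.Lalgebra_isAlgebra.Build R (quat R) (@quat_scaleAr R).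

(* Decidable units, hence the group {unit quat R}, for finite R; as everywhere,
   unitrP characterizes GRing.unit by the existence of a two-sided inverse. *)
HB.instance Definition _ (R : finComNzRingType) :=
  FinRing.isNzRing.Build (quat R).

(* Main.v *)
Require Import Defs.
From mathcomp Require Import all_boot all_order all_algebra.
From mathcomp Require Import ring.

(** The quaternion norm [N q = w^2 + x^2 + y^2 + z^2] is multiplicative and
    [q * conj q = N q], so a quaternion is a unit exactly when its norm is a
    unit of the base ring ([quat_unitE]).  For [n = 2 ^ t] the units of
    [Z_n] are the odd residues, and parity is compatible with the ring
    operations because [n] is even.  Since [N (q + 1) = N q + 1 + 2 w], adding
    [1] flips the parity of the norm; the translation [q |-> q + 1] therefore
    exchanges units and non-units ([quat_unit_add1]).  Hence exactly half of
    the [2 ^ (4 t)] quaternions are units, and half of a nontrivial power of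
    [2] is the value of the totient function there. *)

Import GRing.Theory.
Local Open Scope ring_scope.

Section Norm.
Variable R : comPzRingType.
Implicit Types p q : quat R.

Definition quat_conj q := Quat (qw q) (- qx q) (- qy q) (- qz q).
Definition quat_norm q := qw q ^+ 2 + qx q ^+ 2 + qy q ^+ 2 + qz q ^+ 2.

Lemma mul_quat_conj q : q * quat_conj q = quat_norm q *: (1 : quat R).
Proof. by rewrite /quat_norm; congr Quat => /=; ring. Qed.

Lemma mul_conj_quat q : quat_conj q * q = quat_norm q *: (1 : quat R).
Proof. by rewrite /quat_norm; congr Quat => /=; ring. Qed.

(** Euler's four-square identity. *)
Lemma quat_normM p q : quat_norm (p * q) = quat_norm p * quat_norm q.
Proof. by rewrite /quat_norm /=; ring. Qed.

Lemma quat_norm1 : quat_norm 1 = 1.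
Proof. by rewrite /quat_norm /=; ring. Qed.

Lemma quat_norm_add1 q : quat_norm (q + 1) = quat_norm q + (qw q + qw q) + 1.
Proof. by rewrite /quat_norm /=; ring. Qed.
End Norm.

Arguments quat_conj {R} q.
Arguments quat_norm {R} q.

(** A unit norm gives the inverse [conj q / N q]; conversely the norm, being
    multiplicative, sends inverses to inverses. *)
Lemma quat_unitE (R : finComUnitRingType) (q : quat R) :
  (q \is a GRing.unit) = (quat_norm q \is a GRing.unit).
Proof.
apply/unitrP/idP=> [[p [_ qp1]] | Nq].
  by apply/unitrPr; exists (quat_norm p); rewrite -quat_normM qp1 quat_norm1.
exists ((quat_norm q)^-1 *: quat_conj q).
by rewrite -scalerAl -scalerAr mul_conj_quat mul_quat_conj scalerA mulVr ?scale1r.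
Qed.

Lemma card_quat (T : finType) : #|{: quat T}| = (#|T| ^ 4)%N.
Proof.
have quat_bij : bijective (@prod_of_quat T).
  by exists (@quat_of_prod T); [exact: prod_of_quatK | exact: quat_of_prodK].
by rewrite (bij_eq_card quat_bij) !card_prod !expnS expn0 muln1 !mulnA.
Qed.

(** By injectivity and finiteness [f] is a bijection, and the hypothesis says
    that the preimage of [A] under it is the complement of [A]. *)
Lemma card_flip (T : finType) (f : T -> T) (A : {set T}) :
  injective f -> (forall x, (f x \in A) = (x \notin A)) -> (#|A|.*2 = #|T|)%N.
Proof.
move=> f_inj fA; rewrite -(cardsC A) -addnn; congr addn.
rewrite -[LHS](on_card_preimset (f := f)); last exact/onW_bij/injF_bij.
by apply: eq_card => x; rewrite !inE fA.
Qed.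

Lemma card_unit_set (U : finUnitRingType) :
  #|[set: {unit U}]| = #|[set x : U | x \is a GRing.unit]|.
Proof. by rewrite cardsT card_sub; apply: eq_card => x; rewrite !inE. Qed.

Lemma expn2_gt1 t : (0 < t)%N -> (1 < 2 ^ t)%N.
Proof. by move=> t_gt0; rewrite -{1}(expn0 2) ltn_exp2l. Qed.

Section PowerOfTwo.
Variable t : nat.
Hypothesis t_gt0 : (0 < t)%N.
Local Notation n := (2 ^ t)%N.

Let n_gt1 : (1 < n)%N := expn2_gt1 t t_gt0.

(** Reduction modulo the even number [n] preserves parity. *)
Lemma odd_ZpD (a b : 'Z_n) : odd (a + b)%R = odd a (+) odd b.
Proof.
have -> : nat_of_ord (a + b)%R = ((a + b) %% n)%N
  by congr modn; exact: Zp_cast.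
by rewrite odd_mod ?oddD // oddX /= orbF gtn_eqF.
Qed.

Lemma Zp_unit_odd (a : 'Z_n) : (a \is a GRing.unit) = odd a.
Proof. by rewrite -[a in LHS]natr_Zp unitZpE // coprime_pexpl // coprime2n. Qed.

(** The parity of [N q + (w + w) + 1] is opposite to that of [N q]. *)
Lemma quat_unit_add1 (q : quat 'Z_n) :
  (q + 1 \is a GRing.unit) = (q \isn't a GRing.unit).
Proof.
rewrite !quat_unitE !Zp_unit_odd quat_norm_add1 !odd_ZpD addbb addbF.
by rewrite (_ : nat_of_ord (1 : 'Z_n) = 1%N) // addbT.
Qed.

End PowerOfTwo.

Local Close Scope ring_scope.

Theorem proposition5 (n t : nat) (t_gt0 : 0 < t) (n_def : n = 2 ^ t) :
  #|[set: {unit quat 'Z_n}]| = totient #|{: quat 'Z_n}|.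
Proof.
rewrite {n}n_def card_unit_set.
set U := [set x | _].
have n_gt1 := expn2_gt1 t t_gt0.
have cardH : #|{: quat 'Z_(2 ^ t)}| = 2 ^ (t * 4).
  by rewrite card_quat card_ord Zp_cast // expnM.
have t4_gt0 : 0 < t * 4 by rewrite muln_gt0 t_gt0.
have half : #|U|.*2 = 2 ^ (t * 4).
  rewrite -cardH; apply: (card_flip _ (fun q => q + 1)%R); first exact: addIr.
  by move=> q; rewrite !inE quat_unit_add1.
apply: double_inj.
by rewrite half cardH totient_pfactor // mul1n -mul2n -expnS prednK.
Qed.
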